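(* Let $p$ be a prime with $p\equiv 3\pmod 4$ and let $1\le j\le p-1$. Then for all non-negative integers $\alpha$ and $n$, $$p_{2,2}\left(p^{2 \alpha+1}(p n+j)+\frac{5\left(p^{2(\alpha+1)}-1\right)}{24}\right) \equiv 0\pmod 2.$$
   Context: For a partition $\lambda$, $\mathrm{mex}_{2,2}(\lambda)$ is the smallest positive even integer that is not a part of $\lambda$; $p_{2,2}(n)$ is the number of partitions $\lambda$ of $n$ with $\mathrm{mex}_{2,2}(\lambda)\equiv 2 \pmod{4}$.
   Formalization: For p = 3 the argument of p_{2,2} is never an integer (e.g. 3 + 5/3), so the claim is undefined there; the formal theorem asserts the congruence whenever the argument is a natural number, which holds for every prime p > 3. *)

(* Defs.v *)
From mathcomp Require Import all_boot all_order all_algebra.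

Set Implicit Arguments.
Unset Strict Implicit.
Unset Printing Implicit Defensive.

Definition is_partition (n : nat) (s : seq nat) : bool :=
  [&& sorted geq s, 0 \notin s & sumn s == n].

Lemma mex22_ex (s : seq nat) :
  exists m : nat, [&& 0 < m, 2 %| m & m \notin s].
Proof.
have le_sumn x : x \in s -> x <= sumn s.
  elim: s => //= y s IHs; rewrite inE => /orP[/eqP->|/IHs/leq_trans->//].
    exact: leq_addr.
  exact: leq_addl.
exists (sumn s).+1.*2; rewrite double_gt0 /= dvdn2 odd_double /=.
apply/negP => /le_sumn; rewrite leqNgt -addnn addSn ltnS.
by rewrite leq_addr.
Qed.

Definition mex22 (s : seq nat) : nat := ex_minn (mex22_ex s).

(* A partition of n has at most n parts, each at most n, so the bounded
   sequences over 'I_n.+1 contain all of them; see [is_partition_bseq]. *)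
Definition p22 (n : nat) : nat :=
  #|[set s : {bseq n of 'I_n.+1} |
      is_partition n (map val s) & mex22 (map val s) == 2 %[mod 4]]|.

Lemma is_partition_bseq (n : nat) (s : seq nat) :
  is_partition n s -> exists t : {bseq n of 'I_n.+1}, map val t = s.
Proof.
case/and3P=> _ s0 /eqP sn.
have le_s x : x \in s -> x < n.+1.
  rewrite -sn ltnS; elim: {s0 sn} s => //= y s IHs.
  rewrite inE => /orP[/eqP->|/IHs/leq_trans->//]; first exact: leq_addr.
  exact: leq_addl.
have sz : size s <= n.
  rewrite -sn; elim: s s0 {sn le_s} => //= y s IHs.
  rewrite inE negb_or eq_sym -lt0n => /andP[y0 /IHs sz].
  by rewrite -add1n leq_add.
have szi : size (map (@inord n) s) <= n by rewrite size_map.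
exists (Bseq szi); rewrite /= -map_comp -[RHS]map_id.
by apply/eq_in_map => x /le_s xn /=; rewrite inordK.
Qed.

(* Main.v *)
Require Import Defs.
From mathcomp Require Import all_boot all_order all_algebra all_field.
From mathcomp Require Import ring zify.

Set Implicit Arguments.
Unset Strict Implicit.
Unset Printing Implicit Defensive.

Import GRing.Theory Num.Theory.

(** The number of [k] such that [2, 4, ..., 2k] are all parts of a partition is
    half its mex, so modulo 2 the generating function of [p22] is
    [(\sum_k q^(k(k+1))) / f], where [f = \prod_i (1 - q^i)].  Modulo 2 the
    numerator is the square of [\sum_k q^(k(k+1)/2)], which is [f^3] by Gauss'
    identity, so the series is [f^5 = f(q) f(q^4)].  By the pentagonal number
    theorem the exponents [e] of [f] satisfy [24 e + 1 = x^2]; hence an odd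
    [p22 N] forces [24 N + 5 = x^2 + (2 y)^2].  For the [N] of the theorem,
    [p] occurs in [24 N + 5] to an odd power, which is impossible since
    [p = 3 %[mod 4]].  Series are handled as polynomials modulo a power
    of ['X]. *)

Local Open Scope ring_scope.

(** * Shanks' finite forms of the identities of Euler and Gauss *)

(** When [n] grows by one, the terms with s <= n change by a telescoping difference. Its boundary
    value and the new last term are the two monomials with k = n + 1 on the right. *)
Lemma shanks_pentagonal (R : comNzRingType) (q : R) (n : nat) :
  \sum_(0 <= s < n.+1) (-1) ^+ s * q ^+ (s * n + 'C(s.+1, 2)) *
     \prod_(s <= i < n) (1 - q ^+ i.+1) =
  1 + \sum_(1 <= k < n.+1) (-1) ^+ k *
        (q ^+ (k ^ 2 + 'C(k, 2)) + q ^+ (k ^ 2 + 'C(k.+1, 2))).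
Proof.
elim: n => [|n IHn].
  by rewrite big_nat1 !big_geq // mul0n !mulr1 addr0.
rewrite [in RHS]big_nat_recr //= addrA -IHn big_nat_recr //=.
rewrite (big_geq (m := n.+1) (n := n.+1)) // mulr1.
(* The telescoping certificate: term s changes by [g s.+1 - g s], and the value 0 at s = 0 leaves
   only [g n.+1]. *)
pose g s := if s is t.+1 then (-1) ^+ t.+1 * q ^+ (t.+1 * n + 'C(t.+2, 2)) *
     \prod_(t <= i < n) (1 - q ^+ i.+1) else 0.
have -> : \sum_(0 <= s < n.+1) (-1) ^+ s * q ^+ (s * n.+1 + 'C(s.+1, 2)) *
     \prod_(s <= i < n.+1) (1 - q ^+ i.+1) =
   \sum_(0 <= s < n.+1) (-1) ^+ s * q ^+ (s * n + 'C(s.+1, 2)) *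
     \prod_(s <= i < n) (1 - q ^+ i.+1) + g n.+1.
  apply/eqP; rewrite addrC -subr_eq -sumrB; apply/eqP.
  rewrite (eq_big_nat _ _ (F2 := fun s => g s.+1 - g s)).
    by rewrite telescope_sumr //= subr0.
  move=> s /andP[_ sn]; rewrite (big_nat_recr n) //= -?ltnS //.
  have -> : (s * n.+1 + 'C(s.+1, 2) = (s * n + 'C(s.+1, 2)) + s)%N by lia.
  have -> : (s.+1 * n + 'C(s.+2, 2) = (s * n + 'C(s.+1, 2)) + s + n.+1)%N.
    by rewrite [in LHS]binS bin1; lia.
  case: s sn => [|s] sn; first by rewrite /= !exprS !exprD; ring.
  by rewrite /= (big_ltn (m := s)) // !exprS !exprD !exprS; ring.
rewrite /= (big_geq (m := n) (n := n)) // mulr1 mulrDr addrA.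
congr (_ + _ * q ^+ _ + _ * q ^+ _); rewrite (binS n.+1 1) bin1; lia.
Qed.

(** A finite form of Gauss' identity with its denominator, the product over odd exponents, cleared.
    The induction telescopes as before, once the sum for [n] is multiplied by the new odd factor. *)
Lemma shanks_triangular (R : comNzRingType) (q : R) (n : nat) :
  \sum_(0 <= s < n.+1) q ^+ (s * n.*2.+1) *
     (\prod_(0 <= i < s) (1 - q ^+ i.*2.+1) *
      \prod_(s <= i < n) (1 - q ^+ i.+1.*2)) =
  (\prod_(0 <= i < n) (1 - q ^+ i.*2.+1)) *
  \sum_(0 <= s < n.*2.+1) q ^+ 'C(s.+1, 2).
Proof.
elim: n => [|n IHn]; first by rewrite !big_nat1 !big_geq // mul0n !mulr1.
pose o s : R := \prod_(0 <= i < s) (1 - q ^+ i.*2.+1).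
have oS s : o s.+1 = o s * (1 - q ^+ s.*2.+1) by rewrite /o big_nat_recr.
rewrite doubleS big_nat_recr //= (big_geq (m := n.+1) (n := n.+1)) // mulr1.
rewrite (big_nat_recr n.*2.+2) //= (big_nat_recr n.*2.+1) //=.
rewrite -/(o n.+1) !mulrDr {2}oS /o.
rewrite [in X in _ = X + _ + _]mulrAC -{}IHn -/(o n.+1).
pose g s := if s is t.+1 then q ^+ (t.+1 * n.*2.+1) * (o t.+1 *
     \prod_(t <= i < n) (1 - q ^+ i.+1.*2)) else 0.
have -> : \sum_(0 <= s < n.+1) q ^+ (s * n.*2.+3) *
     (\prod_(0 <= i < s) (1 - q ^+ i.*2.+1) *
      \prod_(s <= i < n.+1) (1 - q ^+ i.+1.*2)) =
   (\sum_(0 <= s < n.+1) q ^+ (s * n.*2.+1) *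
     (\prod_(0 <= i < s) (1 - q ^+ i.*2.+1) *
      \prod_(s <= i < n) (1 - q ^+ i.+1.*2))) * (1 - q ^+ n.*2.+1) + g n.+1.
  apply/eqP; rewrite addrC -subr_eq mulr_suml -sumrB; apply/eqP.
  rewrite (eq_big_nat _ _ (F2 := fun s => g s.+1 - g s)).
    by rewrite telescope_sumr //= subr0.
  move=> s /andP[_ sn]; rewrite (big_nat_recr n) //= -?ltnS // -/(o s) oS.
  have -> : (s * n.*2.+3 = s * n.*2.+1 + s + s)%N by lia.
  rewrite mulSn exprD -!addnn.
  case: s sn => [|s] sn; first by rewrite /= ?(exprS, exprD); ring.
  rewrite /= (big_ltn (m := s)) // -!addnn.
  by rewrite ?(exprS, exprD, addnS, addSn); ring.
rewrite /= (big_geq (m := n) (n := n)) // mulr1.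
by rewrite -!addrA ![o _ * _]mulrC; congr (_ + (q ^+ _ * _ + q ^+ _ * _));
  rewrite bin2; nia.
Qed.

(** * Polynomials modulo a power of the variable *)

Definition eqmodX (F : fieldType) (m : nat) (p q : {poly F}) :=
  p %% 'X^m = q %% 'X^m.

Lemma eqmodXM (F : fieldType) m (p p' q q' : {poly F}) :
  eqmodX m p p' -> eqmodX m q q' -> eqmodX m (p * q) (p' * q').
Proof.
have mul2l (a b c : {poly F}) : eqmodX m b c -> eqmodX m (a * b) (a * c).
  by rewrite /eqmodX -modp_mul => ->; rewrite modp_mul.
move=> pp' qq'; apply: (etrans (mul2l p q q' qq')).
by rewrite ![_ * q']mulrC; apply: mul2l.
Qed.

Lemma eqmodXD (F : fieldType) m (p p' q q' : {poly F}) :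
  eqmodX m p p' -> eqmodX m q q' -> eqmodX m (p + q) (p' + q').
Proof. by rewrite /eqmodX !modpD => -> ->. Qed.

Lemma eqmodX_exp (F : fieldType) m (p q : {poly F}) k :
  eqmodX m p q -> eqmodX m (p ^+ k) (q ^+ k).
Proof.
by move=> pq; elim: k => [//|k IHk]; rewrite !exprS; apply: eqmodXM.
Qed.

Lemma eqmodX_sum (F : fieldType) m (I : Type) (r : seq I) (P : pred I)
    (f g : I -> {poly F}) :
  (forall i, P i -> eqmodX m (f i) (g i)) ->
  eqmodX m (\sum_(i <- r | P i) f i) (\sum_(i <- r | P i) g i).
Proof. exact: (big_ind2 (@eqmodX F m) erefl (@eqmodXD F m)). Qed.

Lemma eqmodX_prod (F : fieldType) m (I : Type) (r : seq I) (P : pred I)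
    (f g : I -> {poly F}) :
  (forall i, P i -> eqmodX m (f i) (g i)) ->
  eqmodX m (\prod_(i <- r | P i) f i) (\prod_(i <- r | P i) g i).
Proof. exact: (big_ind2 (@eqmodX F m) erefl (@eqmodXM F m)). Qed.

Lemma eqmodX_sum0 (F : fieldType) m (I : eqType) (r : seq I)
    (f : I -> {poly F}) :
  {in r, forall i, eqmodX m (f i) 0} -> eqmodX m (\sum_(i <- r) f i) 0.
Proof.
move=> f0; rewrite big_seq; apply: (etrans (eqmodX_sum r f0)).
by rewrite big1_eq.
Qed.

Lemma eqmodX_prod1 (F : fieldType) m (I : eqType) (r : seq I)
    (f : I -> {poly F}) :
  {in r, forall i, eqmodX m (f i) 1} -> eqmodX m (\prod_(i <- r) f i) 1.
Proof.
move=> f1; rewrite big_seq; apply: (etrans (eqmodX_prod r f1)).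
by rewrite big1_eq.
Qed.

Lemma eqmodX_MXn0 (F : fieldType) m e (p : {poly F}) :
  (m <= e)%N -> eqmodX m ('X^e * p) 0.
Proof.
by move=> le_me; rewrite /eqmodX mod0p; apply/modp_eq0P/dvdp_mulr/dvdp_exp2l.
Qed.

Lemma eqmodX_Xn0 (F : fieldType) m e :
  (m <= e)%N -> eqmodX m ('X^e : {poly F}) 0.
Proof. by rewrite -['X^e]mulr1; apply: eqmodX_MXn0. Qed.

Lemma eqmodX_subXn (F : fieldType) m (p : {poly F}) e :
  (m <= e)%N -> eqmodX m (p - 'X^e) p.
Proof.
by move=> /(@eqmodX_Xn0 F) e0; rewrite /eqmodX modpD modpN e0 mod0p subr0.
Qed.

Lemma coef_eqmodX (F : fieldType) m (p q : {poly F}) i :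
  (i < m)%N -> eqmodX m p q -> p`_i = q`_i.
Proof.
move=> lt_im pq; rewrite (divp_eq p 'X^m) (divp_eq q 'X^m) pq.
by rewrite !coefD !coefMXn lt_im.
Qed.

Lemma eqmodX_dvd (F : fieldType) m (p q : {poly F}) :
  ('X^m %| p - q) = (p %% 'X^m == q %% 'X^m).
Proof.
apply/idP/eqP => [/modp_eq0P/eqP|pq].
  by rewrite modpD modpN subr_eq0 => /eqP.
by apply/modp_eq0P; rewrite modpD modpN pq subrr.
Qed.

(** A nonzero constant term makes [p] coprime to ['X^m]; this replaces division by an invertible
    power series. *)
Lemma eqmodX_mulI (F : fieldType) m (p q r : {poly F}) :
  p.[0] != 0 -> eqmodX m (p * q) (p * r) -> eqmodX m q r.
Proof.
rewrite /eqmodX => p0 /eqP; rewrite -eqmodX_dvd -mulrBr => dvd_pqr.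
apply/eqP; rewrite -eqmodX_dvd -(Gauss_dvdpr _ (q := p)) //.
by apply: coprimep_expl; rewrite coprimep_sym coprimepX.
Qed.

(** * Euler's product and the pentagonal exponents *)

Definition euler_poly (F : fieldType) n : {poly F} :=
  \prod_(0 <= i < n) (1 - 'X^(i.+1)).

Lemma euler_poly_at0 (F : fieldType) n : (euler_poly F n).[0] = 1.
Proof.
rewrite horner_prod big1 // => i _.
by rewrite !hornerE expr0n subr0.
Qed.

Lemma eqmodX_euler_poly (F : fieldType) n m :
  (n <= m)%N -> eqmodX n.+1 (euler_poly F m) (euler_poly F n).
Proof.
move=> le_nm; rewrite /euler_poly (big_cat_nat (n := n)) //=.
rewrite -[X in eqmodX _ _ X]mulr1.
apply: eqmodXM => //; apply: eqmodX_prod1 => i.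
by rewrite mem_index_iota => /andP[ni _]; apply: eqmodX_subXn.
Qed.

(** In [shanks_pentagonal] the term s = 0 is the whole product, and every term with s >= 1 carries
    an exponent of at least n + 1. *)
Lemma euler_poly_pentagonal (F : fieldType) n :
  eqmodX n.+1 (euler_poly F n)
    (1 + \sum_(1 <= k < n.+1) (-1) ^+ k *
        ('X^(k ^ 2 + 'C(k, 2)) + 'X^(k ^ 2 + 'C(k.+1, 2)))).
Proof.
rewrite -shanks_pentagonal big_ltn // mul0n !mul1r -/(euler_poly F n).
rewrite -[X in eqmodX _ X _]addr0; apply: eqmodXD => //.
apply/esym/eqmodX_sum0 => -[|s]; rewrite mem_index_iota // => _.
rewrite -mulrA -[X in eqmodX _ _ X](mulr0 ((-1) ^+ s.+1)).
apply: eqmodXM => //; apply: eqmodX_MXn0.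
by rewrite mulSn binS bin1; lia.
Qed.

(** Besides 0, the exponents are k(3k - 1)/2 and k(3k + 1)/2, for which 24 e + 1 is (6k - 1)^2 and
    (6k + 1)^2. *)
Lemma coef_euler_poly_neq0 (F : fieldType) n i :
  (i <= n)%N -> (euler_poly F n)`_i != 0 ->
  exists x, (24 * i + 1 = x ^ 2)%N.
Proof.
move=> le_in; rewrite (coef_eqmodX _ (euler_poly_pentagonal F n)) //.
(* A bounded search decides existence, so that one may argue by contradiction; any root of 24 i + 1
   is below 24 i + 2. *)
case sq: (has (fun x => 24 * i + 1 == x ^ 2)%N (iota 0 (24 * i + 2))).
  by case/hasP: sq => x _ /eqP ->; exists x.
have nosq x : (24 * i + 1 != x ^ 2)%N.
  apply: contraFN sq => /eqP sq; apply/hasP; exists x; last exact/eqP.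
  by rewrite mem_iota; nia.
rewrite coefD coef1 coef_sum big1_seq ?addr0.
  by case: i {le_in sq} nosq => [/(_ 1%N)|i]; rewrite ?eqxx.
move=> k /andP[_]; rewrite mem_index_iota => /andP[k0 _].
have coefX0 e : (exists x, 24 * e + 1 = x ^ 2)%N -> ('X^e : {poly F})`_i = 0.
  case=> x ex; rewrite coefXn; case: eqP => // ie.
  by have := nosq x; rewrite ie ex eqxx.
have bk1 : ('C(k.+1, 2) = 'C(k, 2) + k)%N by rewrite binS bin1.
have b2 : (2 * 'C(k.+1, 2) = k * k.+1)%N by rewrite mul_bin_left subn1 bin1.
have c0 : ('X^(k ^ 2 + 'C(k, 2)) + 'X^(k ^ 2 + 'C(k.+1, 2)) : {poly F})`_i = 0.
  rewrite coefD !coefX0 ?addr0 //; last by exists (6 * k - 1)%N; nia.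
  by exists (6 * k + 1)%N; nia.
by rewrite -signr_odd mulr_sign; case: odd; rewrite ?coefN c0 ?oppr0.
Qed.

(** * Frobenius and Gauss' identity over F_2 *)

Lemma pchar_F2 : 2 \in [pchar {poly 'F_2}].
Proof. by rewrite pchar_poly pchar_Fp. Qed.

(** Squaring is additive in characteristic 2 and fixes the scalars of F_2, so it only doubles
    exponents. *)
Lemma sqr_poly_F2 (p : {poly 'F_2}) : p ^+ 2 = p \Po 'X^2.
Proof.
elim/poly_ind: p => [|p c IHp]; first by rewrite comp_poly0 expr0n.
rewrite comp_poly_MXaddC -IHp.
rewrite -(pFrobenius_autE pchar_F2 (p * 'X + c%:P)) rmorphD /= !pFrobenius_autE.
rewrite exprMn -rmorphXn /=; congr (_ + _%:P).
by case: c => [[|[|c]] lt_c]; apply/val_inj.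
Qed.

Lemma exp4_poly_F2 (p : {poly 'F_2}) : p ^+ 4 = p \Po 'X^4.
Proof.
rewrite (exprM p 2 2) (sqr_poly_F2 (p ^+ 2)) (sqr_poly_F2 p).
by rewrite -comp_polyA comp_Xn_poly -exprM.
Qed.

Definition triangular_poly (F : fieldType) n : {poly F} :=
  \sum_(0 <= s < n.*2.+1) 'X^('C(s.+1, 2)).

(** Let f be the Euler polynomial and T the triangular one. Split the product into odd factors [o]
    and even factors [e]: modulo 2, e = f(q^2) = f^2, and Gauss gives e = o T, so f^4 = e o T = f
    T. *)
Lemma euler_poly_triangular n :
  eqmodX n.+1 (euler_poly 'F_2 n ^+ 4)
    (euler_poly 'F_2 n * triangular_poly 'F_2 n).
Proof.
pose o : {poly 'F_2} := \prod_(0 <= i < n) (1 - 'X^(i.*2.+1)).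
pose e : {poly 'F_2} := \prod_(0 <= i < n) (1 - 'X^(i.+1.*2)).
have oe : o * e = euler_poly _ n.*2.
  rewrite /o /e /euler_poly; elim: (n) => [|k IHk].
    by rewrite !big_geq ?mulr1.
  by rewrite doubleS !big_nat_recr //= -IHk -doubleS; ring.
have e2 : e = euler_poly _ n ^+ 2.
  rewrite sqr_poly_F2 rmorph_prod; apply: eq_bigr => i _ /=.
  by rewrite rmorphB rmorph1 /= comp_Xn_poly -exprM mul2n.
have eot : eqmodX n.+1 e (o * triangular_poly _ n).
  rewrite -shanks_triangular big_ltn // [\prod_(0 <= i < 0) _]big_geq //.
  rewrite mul0n !mul1r -/e -[X in eqmodX _ X _]addr0; apply: eqmodXD => //.
  apply/esym/eqmodX_sum0 => -[|s]; rewrite mem_index_iota // => _.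
  by apply: eqmodX_MXn0; lia.
rewrite (exprM _ 2 2) -e2 expr2; apply: (etrans (eqmodXM (erefl (e %% _)) eot)).
rewrite mulrA [e * o]mulrC oe; apply: eqmodXM => //.
by apply: eqmodX_euler_poly; lia.
Qed.

Lemma sqr_triangular_poly n :
  triangular_poly 'F_2 n ^+ 2 = \sum_(0 <= s < n.*2.+1) 'X^(s * s.+1).
Proof.
rewrite sqr_poly_F2 rmorph_sum; apply: eq_bigr => s _ /=.
by rewrite comp_Xn_poly -exprM mul_bin_left subn1 bin1.
Qed.

(** * Partitions and multiplicities *)

Lemma mem_mex22 (s : seq nat) k :
  all (fun i => i.*2 \in s) (iota 1 k) = (k.*2 < mex22 s)%N.
Proof.
rewrite /mex22; case: ex_minnP => m /and3P[m0 m2 ms] min_m.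
apply/allP/idP => [ks|km i].
  rewrite ltnNge; apply: contra ms => mk; rewrite -(divnK m2) muln2.
  by apply: ks; rewrite mem_iota; lia.
rewrite mem_iota => ik; apply/negPn/negP => si.
have : (m <= i.*2)%N by apply: min_m; rewrite si dvdn2 odd_double; lia.
lia.
Qed.

Lemma leq_sumn (s : seq nat) x : x \in s -> (x <= sumn s)%N.
Proof.
elim: s => //= y s IHs; rewrite inE => /orP[/eqP->|/IHs]; lia.
Qed.

(** If the mex is 2m, the sum counts the k < m, and m is odd exactly when 2m is 2 modulo 4. The
    range reaches m because 2(n/2 + 1), with n/2 rounded down, exceeds n and so is not a part. *)
Lemma mex22_parity (s : seq nat) (n : nat) : sumn s = n ->
  (mex22 s == 2 %[mod 4])%N =
  odd (\sum_(0 <= k < n./2.+1) all (fun i => i.*2 \in s) (iota 1 k)).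
Proof.
move=> sn; under eq_bigr do rewrite mem_mex22.
have [m0 m2 lemn] : [/\ 0 < mex22 s, 2 %| mex22 s
    & mex22 s <= n./2.+1.*2]%N.
  have allP k := mem_mex22 s k.
  rewrite /mex22 in allP *; case: ex_minnP allP => m /and3P[m0 m2 ms] min_m mk.
  split=> //; rewrite leqNgt; apply/negP => nm.
  have : (n./2.+1.*2 \in s).
    have := mk n./2.+1; rewrite nm => /allP; apply.
    by rewrite mem_iota; lia.
  by move/leq_sumn; rewrite sn; lia.
have {m2} [m em] : exists m, mex22 s = m.*2.
  by exists (mex22 s %/ 2)%N; rewrite -muln2 divnK.
rewrite em in m0 lemn *.
have -> : (\sum_(0 <= k < n./2.+1) (k.*2 < m.*2) = m)%N.
  rewrite (big_cat_nat (n := m)) //=; last by lia.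
  rewrite big_nat (eq_bigr (fun=> 1%N)); last by move=> k; lia.
  rewrite -big_nat [X in (_ + X)%N]big1_seq => [|k]; last first.
    by rewrite mem_index_iota; lia.
  by rewrite sum_nat_const_nat; lia.
lia.
Qed.

(** Index i stands for the part i + 1. When the sum of [s] is n, no multiplicity exceeds n and
    [inord] keeps its value. *)
Definition mult_ffun n (s : seq nat) : {ffun 'I_n -> 'I_n.+1} :=
  [ffun i => inord (count_mem (val i).+1 s)].

Lemma leq_count_sumn x (s : seq nat) : (x.+1 * count_mem x.+1 s <= sumn s)%N.
Proof.
elim: s => [|y s IHs] /=; first by rewrite muln0.
case: eqP => [->|_]; first by rewrite mulnS leq_add2l.
exact: leq_trans IHs (leq_addl _ _).
Qed.

Lemma mult_ffunE n (s : seq nat) (i : 'I_n) : sumn s = n ->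
  val (mult_ffun n s i) = count_mem (val i).+1 s.
Proof.
move=> sn; rewrite ffunE /= inordK // ltnS -[leqRHS]sn.
exact: leq_trans (leq_pmull _ _) (leq_count_sumn i s).
Qed.

Lemma sumn_count n (s : seq nat) :
  {in s, forall x, x <= n}%N ->
  (sumn s = \sum_(i < n) i.+1 * count_mem (val i).+1 s)%N.
Proof.
elim: s => [|y s IHs] sn /=; first by rewrite big1 // => i _; rewrite muln0.
under eq_bigr do rewrite mulnDr; rewrite big_split /= -IHs; last first.
  by move=> x xs; apply: sn; rewrite inE xs orbT.
congr (_ + _)%N; have := sn y (mem_head _ _); case: y {sn} => [|y] yn.
  by rewrite big1 // => i _; rewrite muln0.
rewrite (bigD1 (Ordinal yn)) //= eqxx big1 ?addn0 ?muln1 // => i.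
by rewrite -val_eqE /= eqSS [y == _]eq_sym => /negPf ->; rewrite muln0.
Qed.

Lemma partition_of_mult n (f : {ffun 'I_n -> 'I_n.+1}) :
  (\sum_i (val i).+1 * f i = n)%N ->
  exists2 s, is_partition n s & mult_ffun n s = f.
Proof.
move=> fn; pose t := flatten [seq nseq (f i) (val i).+1 | i <- enum 'I_n].
have ct i : count_mem (val i).+1 t = f i.
  rewrite count_flatten -map_comp sumnE big_map big_enum /= (bigD1 i) //=.
  rewrite big1 ?addn0; last first.
    by move=> j ji; rewrite count_nseq /= eqSS (inj_eq val_inj) (negPf ji).
  by rewrite count_nseq /= eqxx mul1n.
have st : sumn t = n.
  rewrite sumn_flatten -map_comp sumnE big_map big_enum /= -[RHS]fn.
  by apply: eq_bigr => i _; rewrite sumn_nseq.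
exists (sort geq t).
  rewrite /is_partition; apply/and3P; split.
  - by apply: sort_sorted => x y; apply: leq_total.
  - by rewrite mem_sort; apply/flatten_mapP => -[i _ /nseqP[]].
  - by rewrite (perm_sumn (_ : perm_eq _ t)) ?perm_sort ?st.
apply/ffunP => i; rewrite ffunE; apply/val_inj.
by rewrite /= (permP (_ : perm_eq _ t)) ?perm_sort // ct inordK.
Qed.

Lemma mult_ffun_inj n (s t : seq nat) :
  is_partition n s -> is_partition n t ->
  mult_ffun n s = mult_ffun n t -> s = t.
Proof.
move=> /and3P[ss s0 /eqP sn] /and3P[ts t0 /eqP tn] st.
apply: (sorted_eq (leT := geq)) => //.
- by move=> x y z xy yz; apply: leq_trans xy.
- by move=> x y; rewrite andbC -eqn_leq => /eqP.
apply/allP => x _; apply/eqP.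
have cnt0 u : 0%N \notin u -> count_mem 0%N u = 0%N by move/count_memPn.
have cntS u y : sumn u = n -> (n <= y)%N -> count_mem y.+1 u = 0%N.
  by move=> un ny; apply/count_memPn/negP => /leq_sumn; rewrite un; lia.
case: x => [|x]; first by rewrite !cnt0.
have [lt_xn|le_nx] := ltnP x n; last by rewrite !cntS.
have /(congr1 val) := congr1 (fun f : {ffun _ -> _} => f (Ordinal lt_xn)) st.
by rewrite !mult_ffunE.
Qed.

(** [C] marks the parts that must occur. Multiplicity functions are what the expansion of a product
    of sums is indexed by. *)
Lemma card_partitions_with_parts n (C : pred nat) :
  #|[set s : {bseq n of 'I_n.+1} | is_partition n (map val s)
      & [forall i : 'I_n, C (val i).+1 ==> ((val i).+1 \in map val s)]]| =
  #|[set f : {ffun 'I_n -> 'I_n.+1} | \sum_i (val i).+1 * f i == n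
      & [forall i : 'I_n, C (val i).+1 ==> (0 < f i)]]|%N.
Proof.
pose g (s : {bseq n of 'I_n.+1}) := mult_ffun n (map val s).
rewrite -(card_in_imset (f := g)); last first.
  move=> s t; rewrite !inE => /andP[sP _] /andP[tP _] /(mult_ffun_inj sP tP).
  by move/(inj_map val_inj)/val_inj.
have CP (s : {bseq n of 'I_n.+1}) (i : 'I_n) :  is_partition n (map val s) ->
    (0 < g s i)%N = ((val i).+1 \in map val s).
  by case/and3P=> _ _ /eqP sn; rewrite mult_ffunE // -has_count has_pred1.
congr #|pred_of_set _|; apply/setP => f; apply/imsetP/idP => [[s sP ->]|].
  move: sP; rewrite !inE => /andP[sP sC]; apply/andP; split.
    case/and3P: (sP) => _ _ /eqP sn; under eq_bigr do rewrite mult_ffunE //.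
    by rewrite -sumn_count ?sn // => x /leq_sumn; rewrite sn.
  by apply/forallP => i; rewrite CP //; apply: (forallP sC).
rewrite inE => /andP[/eqP /partition_of_mult[s sP <-] fC].
have [t ts] := is_partition_bseq sP; subst s.
exists t => //; rewrite inE sP; apply/forallP => i; rewrite -CP //.
exact: (forallP fC).
Qed.

(** * The generating function modulo 2 *)

(** One truncated geometric series per part; a part in [C] starts at multiplicity 1. *)
Definition partition_gf (F : fieldType) n (C : pred nat) : {poly F} :=
  \prod_(i < n) \sum_(m < n.+1 | C i.+1 ==> (0 < m)%N) 'X^(i.+1 * m).

Lemma coef_partition_gf (F : fieldType) n (C : pred nat) :
  (partition_gf F n C)`_n =
  #|[set f : {ffun 'I_n -> 'I_n.+1} | (\sum_i (val i).+1 * f i == n)%N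
      & [forall i : 'I_n, C (val i).+1 ==> (0 < f i)%N]]|%:R.
Proof.
rewrite /partition_gf; under eq_bigr do rewrite big_mkcond.
rewrite bigA_distr_bigA coef_sum -sum1_card natr_sum [RHS]big_mkcond /=.
apply: eq_bigr => f _; rewrite inE.
have [/forallP fC|/forallPn[i fi]] :=
  boolP [forall i : 'I_n, C (val i).+1 ==> (0 < f i)%N].
  rewrite (eq_bigr (fun i : 'I_n => 'X^(i.+1 * f i))) => [|i _]; last first.
    by rewrite fC.
  rewrite -(big_morph _ (exprD 'X) (expr0 'X)).
  by rewrite coefXn eq_sym andbT; case: eqP.
by rewrite (bigD1 i) //= (negPf fi) mul0r coef0 andbF.
Qed.

(** Factor by factor, the geometric sum gives 1 - q^(i(n+1)), or q^i - q^(i(n+1)) if i is in [C],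
    and q^(i(n+1)) vanishes modulo q^(n+1). *)
Lemma euler_poly_partition_gf (F : fieldType) n (C : pred nat) :
  eqmodX n.+1 (euler_poly F n * partition_gf F n C)
    'X^(\sum_(i < n | C i.+1) i.+1)%N.
Proof.
rewrite /euler_poly big_mkord -big_split /= (big_morph _ (exprD 'X) (expr0 'X)).
rewrite [X in eqmodX _ _ X]big_mkcond; apply: eqmodX_prod => i _.
case: (C i.+1) => /=.
  rewrite big_mkcond big_ord_recl /= add0r.
  under eq_bigr do rewrite mulnS exprD exprM.
  rewrite -mulr_sumr mulrCA -opprB mulNr -subrX1.
  rewrite opprB mulrBr mulr1 -exprM -exprD.
  by apply: eqmodX_subXn; rewrite -mulnS leq_pmull.
under eq_bigr do rewrite exprM.
rewrite -opprB mulNr -subrX1 opprB -exprM.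
by apply: eqmodX_subXn; rewrite leq_pmull.
Qed.

Definition even_upto k : pred nat := fun x => ~~ odd x && (x <= k.*2)%N.

Lemma sum_even_upto n k : (k <= n./2)%N ->
  (\sum_(i < n | even_upto k i.+1) i.+1 = k * k.+1)%N.
Proof.
move=> kn; rewrite -(big_mkord (fun i => even_upto k i.+1) succn).
rewrite (big_cat_nat (n := k.*2)) //=; last by lia.
rewrite [X in (_ + X)%N]big1_seq ?addn0; last first.
  by move=> i; rewrite mem_index_iota /even_upto; lia.
rewrite big_nat_cond.
rewrite (eq_bigl (fun i => (0 <= i < k.*2) && odd i)%N) => [|i]; last first.
  by rewrite /even_upto /= negbK; case: odd; rewrite ?andbF // !andbT; lia.
rewrite -big_nat_cond; elim: k {kn} => [|k IHk]; first by rewrite big_geq.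
rewrite doubleS !(big_mkcond odd) !big_nat_recr //=.
rewrite -big_mkcond IHk /= odd_double.
by rewrite /=; nia.
Qed.

Lemma forall_even_upto n k (s : seq nat) : (k <= n./2)%N ->
  [forall i : 'I_n, even_upto k (val i).+1 ==> ((val i).+1 \in s)] =
  all (fun i => i.*2 \in s) (iota 1 k).
Proof.
move=> kn; apply/forallP/allP => [sk i|sk i].
  rewrite mem_iota => ik.
  have lt_in : (i.*2.-1 < n)%N by lia.
  have e : (val (Ordinal lt_in)).+1 = i.*2 by rewrite /= prednK //; lia.
  have /implyP := sk (Ordinal lt_in); rewrite e; apply.
  by rewrite /even_upto odd_double leq_double; lia.
case: i => i lt_in; apply/implyP => /andP[]; rewrite [val _]/= => odd_i le_ik.
rewrite -[i.+1]even_halfK //; apply: sk; rewrite mem_iota; lia.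
Qed.

Lemma natr_odd_F2 m : (odd m)%:R = m%:R :> 'F_2.
Proof.
rewrite -[m in RHS]odd_double_half natrD -muln2 natrM.
by rewrite [2%:R](pcharf0 (pchar_Fp (isT : prime 2))) mulr0 addr0.
Qed.

(** Modulo 2 the indicator of the mex condition becomes the sum of [mex22_parity]; exchanging the
    sums leaves, for each k, the count of partitions containing 2, 4, ..., 2k. *)
Lemma p22_partition_gf n :
  (p22 n)%:R = (\sum_(0 <= k < n./2.+1) partition_gf 'F_2 n (even_upto k))`_n.
Proof.
rewrite coef_sum; under eq_bigr do
  rewrite coef_partition_gf -card_partitions_with_parts.
rewrite /p22 -sum1_card natr_sum.
under eq_bigl do rewrite inE.
rewrite big_mkcondr /=.
rewrite (eq_bigr (fun s : {bseq n of 'I_n.+1} => \sum_(0 <= k < n./2.+1)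
  (all (fun i => i.*2 \in map val s) (iota 1 k))%:R)); last first.
  move=> s /and3P[_ _ /eqP sn].
  by rewrite -natr_sum -natr_odd_F2 -mex22_parity //; case: eqP.
rewrite exchange_big /= big_nat [RHS]big_nat; apply: eq_bigr => k /andP[_ kn].
rewrite -sum1_card natr_sum.
under [RHS]eq_bigl do rewrite inE forall_even_upto //.
by rewrite [RHS]big_mkcondr /=; apply: eq_bigr => s _; case: all.
Qed.

(** The k-th summand contributes q^(2 + 4 + ... + 2k) = q^(k(k+1)); the remaining terms of the
    square have k > n/2, hence k(k+1) > n. *)
Lemma euler_poly_p22_gf n :
  eqmodX n.+1
    (euler_poly 'F_2 n *
     \sum_(0 <= k < n./2.+1) partition_gf 'F_2 n (even_upto k))
    (triangular_poly 'F_2 n ^+ 2).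
Proof.
rewrite sqr_triangular_poly.
rewrite (big_cat_nat (n := n./2.+1) (p := n.*2.+1)) //=; last by lia.
rewrite -[X in eqmodX _ X _]addr0; apply: eqmodXD; last first.
  apply/esym/eqmodX_sum0 => k; rewrite mem_index_iota => /andP[nk _].
  by apply: eqmodX_Xn0; nia.
rewrite mulr_sumr [X in eqmodX _ X _]big_nat [X in eqmodX _ _ X]big_nat.
apply: eqmodX_sum => k /andP[_ kn].
by have := euler_poly_partition_gf 'F_2 n (even_upto k); rewrite sum_even_upto.
Qed.

(** With f G = T^2 and f T = f^4, multiplying by f^3 gives f^3 G = (f T)^2 = f^8, and f^3
    cancels. *)
Lemma p22_euler_poly n : (p22 n)%:R = (euler_poly 'F_2 n ^+ 5)`_n.
Proof.
rewrite p22_partition_gf; set G := \sum_(0 <= k < _) _.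
apply: (coef_eqmodX (ltnSn n)); set P := euler_poly _ n.
apply: (@eqmodX_mulI _ _ (P ^+ 3)).
  by rewrite horner_exp euler_poly_at0 expr1n oner_neq0.
have PG : eqmodX n.+1 (P ^+ 3 * G) ((P * triangular_poly _ n) ^+ 2).
  rewrite [P ^+ 3]exprSr exprMn -mulrA.
  by apply: eqmodXM => //; apply: euler_poly_p22_gf.
apply: (etrans PG); rewrite -exprD (exprM P 4 2).
exact: (eqmodX_exp 2 (esym (euler_poly_triangular n))).
Qed.

(** A nonzero coefficient of f(q) f(q^4) at n needs n = i + 4k with i and k exponents of f, so 24 n
    + 5 = (24 i + 1) + 4 (24 k + 1). *)
Lemma p22_even n :
  (forall x y, 24 * n + 5 <> x ^ 2 + y ^ 2)%N -> (p22 n = 0 %[mod 2])%N.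
Proof.
move=> nosum; rewrite mod0n; apply/eqP; rewrite -/(dvdn _ _).
rewrite (dvdn_pcharf (pchar_Fp (isT : prime 2))) p22_euler_poly.
rewrite exprS exp4_poly_F2.
rewrite coefM big1 // => i _; rewrite coef_comp_poly_Xn //.
case: ifP => [/dvdnP[k nik]|_]; last by rewrite mulr0.
rewrite nik mulnK //; apply/eqP; apply: contraT; rewrite mulf_eq0 negb_or.
have lt_in := ltn_ord i.
case/andP=> /coef_euler_poly_neq0[|x ix]; first by lia.
move/coef_euler_poly_neq0=> [|y ky]; first by lia.
by case: (nosum x (2 * y)%N); nia.
Qed.

(** * Sums of two squares *)

(** Otherwise raise x^2 = -y^2 in F_p to the odd power (p - 1)/2: by Fermat's little theorem 1 = -1,
    or 1 = 0 if y vanishes. *)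
Lemma dvdn_sum2sqr (p x y : nat) :
  prime p -> (p = 3 %[mod 4])%N -> (p %| x ^ 2 + y ^ 2)%N -> (p %| x)%N.
Proof.
move=> pr_p p4; have pcharp := pchar_Fp pr_p.
rewrite !(dvdn_pcharf pcharp) natrD !natrX.
set a : 'F_p := x%:R; set b : 'F_p := y%:R.
move=> ab; apply: contraTT ab => a0.
have fermat (c : 'F_p) : c != 0 -> c ^+ p.-1 = 1.
  move=> c0; apply: (mulfI c0); rewrite -exprS prednK ?prime_gt0 // mulr1.
  by have := expf_card c; rewrite card_Fp.
rewrite addr_eq0; apply: contraNneq a0 => /(congr1 (fun c => c ^+ p.-1./2)).
have p_odd : odd p.-1./2 by lia.
rewrite exprNn -signr_odd p_odd -!exprM mul2n even_halfK; last by lia.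
have [b0|/fermat ->] := eqVneq b 0.
  rewrite b0 expr0n; have -> : (p.-1 == 0)%N = false by lia.
  by rewrite mulr0 => /eqP; rewrite expf_eq0 => /andP[].
have [//|/fermat ->] := eqVneq a 0.
rewrite expr1 mulr1 => /eqP.
rewrite -addr_eq0 -[1 + 1]/(2%:R) -(dvdn_pcharf pcharp).
by move/dvdn_leq => /(_ isT); lia.
Qed.

(** Descent: p divides both x and y, so p^2 can be removed from both sides until k = 0, where it
    would force p to divide m. *)
Lemma sum2sqr_odd_val (p m k x y : nat) :
  prime p -> (p = 3 %[mod 4])%N -> ~~ (p %| m)%N ->
  (p ^ k.*2.+1 * m <> x ^ 2 + y ^ 2)%N.
Proof.
move=> pr_p p4 pm; elim: k x y => [|k IHk] x y xy.
all: have dvd_xy : (p %| x ^ 2 + y ^ 2)%N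
  by rewrite -xy ?doubleS expnS -mulnA dvdn_mulr.
all: have /dvdnP[x' xE] := dvdn_sum2sqr pr_p p4 dvd_xy.
all: rewrite addnC in dvd_xy; have /dvdnP[y' yE] := dvdn_sum2sqr pr_p p4 dvd_xy.
all: have p0 := prime_gt0 pr_p.
  move/negP: pm; apply; apply/dvdnP; exists (x' ^ 2 + y' ^ 2)%N.
  apply/eqP; rewrite -(eqn_pmul2l p0) -[(p * m)%N]/(p ^ 1 * m)%N.
  rewrite [(p ^ 1 * m)%N]xy xE yE.
  by apply/eqP; nia.
apply: (IHk x' y'); apply/eqP; rewrite -(eqn_pmul2l p0) -(eqn_pmul2l p0).
rewrite doubleS !expnS -!mulnA in xy; rewrite !expnS -!mulnA xy xE yE.
by apply/eqP; nia.
Qed.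

Local Close Scope ring_scope.

Theorem theorem3p4 (p j alpha n N : nat)
  (hp : prime p) (hp4 : p = 3 %[mod 4]) (hj : 1 <= j <= p - 1)
  (hN : (N%:R = p%:R ^+ (2 * alpha + 1) * (p%:R * n%:R + j%:R)
          + 5 * (p%:R ^+ (2 * (alpha + 1)) - 1) / 24 :> rat)%R) :
  p22 N = 0 %[mod 2].
Proof.
(* Multiplying N by 24 and adding 5 cancels the -5, and p^(2 alpha + 1) factors out with cofactor
   [m]. *)
pose m := 24 * (p * n + j) + 5 * p.
have NE : 24 * N + 5 = p ^ alpha.*2.+1 * m.
  apply/eqP; rewrite -(eqr_nat rat) !(natrD, natrM, natrX) hN.
  have -> : 2 * (alpha + 1) = alpha.*2.+2 by lia.
  have -> : 2 * alpha + 1 = alpha.*2.+1 by lia.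
  rewrite [(_ ^+ alpha.*2.+2)%R]exprS; apply/eqP.
  by move: (p%:R ^+ alpha.*2.+1)%R => c; field.
apply: p22_even => x y; rewrite NE; apply: sum2sqr_odd_val => //.
apply/negP => pm.
(* Since 0 < j < p, p could divide [m] only by dividing 24, that is for p = 2, excluded modulo 4, or
   p = 3. *)
have mE : m = p * (24 * n + 5) + 24 * j by rewrite /m; lia.
have p24j : p %| 24 * j by move: pm; rewrite mE dvdn_addr // dvdn_mulr.
have pj : ~~ (p %| j) by apply/negP => /dvdn_leq; lia.
move: p24j; rewrite Euclid_dvdM // (negPf pj) orbF.
rewrite -[24]/(2 ^ 3 * 3) Euclid_dvdM // Euclid_dvdX // andbT.
case/orP=> /dvdn_leq => /(_ isT) p_le; first lia.
have p3 : p = 3 by lia.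
(* [p = 3] is excluded because then 3 divides [24 * N + 5]. *)
by move: NE; rewrite p3 expnS -mulnA; lia.
Qed.
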